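(* Let $\mathbf{A}\in\mathbb{C}^{N\times N}$ be nonsingular, let $\mathbf{U}\in\mathbb{C}^{N\times k}$ have rank $k$, where $0<k<N$, and let $\mathcal{U}:=\mathrm{im}(\mathbf{U})$. Let $$\mathbf{P}_{\mathbf{A}}:=\mathbf{I}-\mathbf{A}\mathbf{U}(\mathbf{U}^{\mathsf H}\mathbf{A}^{\mathsf H}\mathbf{A}\mathbf{U})^{-1}\mathbf{U}^{\mathsf H}\mathbf{A}^{\mathsf H},\qquad \widehat{\mathbf{A}}:=\mathbf{P}_{\mathbf{A}}\mathbf{A}.$$ Then $\ker(\widehat{\mathbf{A}})\cap\mathrm{im}(\widehat{\mathbf{A}})=\{\mathbf{0}\}$ if and only if $\mathcal{U}\cap(\mathbf{A}\mathcal{U})^{\perp}=\{\mathbf{0}\}$. In particular, the latter condition is satisfied when $\mathcal{U}$ is an exactly $\mathbf{A}$-invariant subspace, i.e., when $\mathbf{A}\mathcal{U}=\mathcal{U}$.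
   Context: The orthogonal complement $^{\perp}$ is taken with respect to the Euclidean inner product on $\mathbb{C}^N$, $^{\mathsf H}$ is the conjugate transpose, and $\mathrm{im}$ denotes the column space. The matrix $\mathbf{U}^{\mathsf H}\mathbf{A}^{\mathsf H}\mathbf{A}\mathbf{U}$ is nonsingular under the stated assumptions. *)

(* Defs.v *)
From HB Require Import structures.
From mathcomp Require Import all_boot all_order all_algebra.
From mathcomp Require Import complex.
From mathcomp Require Import boolp classical_sets reals.

Set Implicit Arguments.
Unset Strict Implicit.
Unset Printing Implicit Defensive.

Import Order.TTheory GRing.Theory Num.Theory.

Local Open Scope ring_scope.
Local Open Scope sesquilinear_scope.
Local Open Scope classical_set_scope.

(* Matrices act on column vectors; mxalgebra's subspaces are row spaces and its
   kermx is a left kernel, so kernel and image are given here as sets. *)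
Definition mxker (C : numClosedFieldType) (m n : nat) (M : 'M[C]_(m, n)) :
    set 'cV[C]_n :=
  [set x | M *m x = 0].

Definition mxim (C : numClosedFieldType) (m n : nat) (M : 'M[C]_(m, n)) :
    set 'cV[C]_m :=
  range (fun x : 'cV[C]_n => M *m x).

(* dotmx is the Euclidean inner product of row vectors, conjugate-linear in its
   second argument; hence the transposes. *)
Definition orthc (C : numClosedFieldType) (n : nat) (S : set 'cV[C]_n) :
    set 'cV[C]_n :=
  [set x | forall y, S y -> dotmx x^T y^T = 0].

Definition proj_A (C : numClosedFieldType) (n k : nat)
    (A : 'M[C]_n) (U : 'M[C]_(n, k)) : 'M[C]_n :=
  1%:M - A *m U *m invmx (U^t* *m A^t* *m A *m U) *m U^t* *m A^t*.

Definition deflated (C : numClosedFieldType) (n k : nat)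
    (A : 'M[C]_n) (U : 'M[C]_(n, k)) : 'M[C]_n :=
  proj_A A U *m A.

(* Main.v *)
(** Write [B = A U], so that [P = proj_A A U] is the orthogonal projection along
    [im B]. Since [A] is nonsingular, [ker (P A)] consists of the [x] with
    [A x] in [im B], which is [im U], and [im (P A) = im P = (im B)^perp]. The
    two intersections are therefore the same set. *)
Require Import Defs.
From mathcomp Require Import all_boot all_order all_algebra.
From mathcomp Require Import complex.
From mathcomp Require Import boolp classical_sets reals.

Set Implicit Arguments.
Unset Strict Implicit.
Unset Printing Implicit Defensive.

Import GRing.Theory.

Local Open Scope ring_scope.
Local Open Scope sesquilinear_scope.
Local Open Scope classical_set_scope.

Lemma adjmx_mul (C : numClosedFieldType) m n p (A : 'M[C]_(m, n))
    (B : 'M[C]_(n, p)) : (A *m B)^t* = B^t* *m A^t*.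
Proof. by rewrite trmx_mul map_mxM. Qed.

Lemma dotmx_tr (C : numClosedFieldType) n (x y : 'cV[C]_n) :
  dotmx x^T y^T = (y^t* *m x) 0 0.
Proof.
by rewrite dotmxE !mxE; apply: eq_bigr => i _; rewrite !mxE mulrC.
Qed.

Lemma dotmx_tr_eq0 (C : numClosedFieldType) n (x : 'cV[C]_n) :
  dotmx x^T x^T = 0 -> x = 0.
Proof.
by move/eqP; rewrite (dnorm_eq0 (@dotmx C n)) trmx_eq0 => /eqP.
Qed.

(** If [v B^t* B = 0], multiplying by [v^t*] on the right shows that [v B^t*] has norm zero; the
    rows of [B^t*] are independent, so [v = 0]. *)
Lemma gram_unitmx (C : numClosedFieldType) m n (B : 'M[C]_(m, n)) :
  \rank B = n -> B^t* *m B \in unitmx.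
Proof.
move=> rkB; rewrite -row_free_unit; apply/inj_row_free => v.
rewrite mulmxA => vG0.
have Bfree : row_free (B^t*) by rewrite /row_free mxrank_map mxrank_tr rkB.
apply/eqP; rewrite -(mulmx_free_eq0 _ Bfree) -(dnorm_eq0 (@dotmx C m)).
apply/eqP; rewrite [LHS]dotmxE adjmx_mul trmxCK mulmxA vG0 mul0mx.
by rewrite mxE.
Qed.

Lemma gram_mul_unitmx (C : numClosedFieldType) n k (A : 'M[C]_n)
    (U : 'M[C]_(n, k)) :
  A \in unitmx -> \rank U = k -> (A *m U)^t* *m (A *m U) \in unitmx.
Proof.
move=> uA rkU; apply: gram_unitmx.
(* Transposing moves [A] to the right, where a factor with independent rows preserves the rank. *)
rewrite -mxrank_tr trmx_mul mxrankMfree ?mxrank_tr //.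
by rewrite row_free_unit unitmx_tr.
Qed.

Lemma orthc_mxim (C : numClosedFieldType) m n (B : 'M[C]_(m, n)) :
  orthc (mxim B) = mxker (B^t*).
Proof.
apply/seteqP; split => x /= xB.
  (* Pairing [x] with the vector [B (B^t* x)] of the image gives the squared norm of [B^t* x]. *)
  apply/dotmx_tr_eq0; rewrite dotmx_tr mulmxA -adjmx_mul -dotmx_tr.
  by apply: xB; exists (B^t* *m x).
by move=> _ [y _ <-]; rewrite dotmx_tr adjmx_mul -mulmxA xB mulmx0 mxE.
Qed.

(** In this form [A U] can be abstracted to a single matrix [B] with invertible Gram matrix. *)
Lemma proj_AE (C : numClosedFieldType) n k (A : 'M[C]_n) (U : 'M[C]_(n, k)) :
  proj_A A U =
  1%:M - (A *m U) *m invmx ((A *m U)^t* *m (A *m U)) *m (A *m U)^t*.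
Proof. by rewrite /proj_A adjmx_mul !mulmxA. Qed.

Lemma mxker_proj_A (C : numClosedFieldType) n k (A : 'M[C]_n)
    (U : 'M[C]_(n, k)) :
  A \in unitmx -> \rank U = k -> mxker (proj_A A U) = mxim (A *m U).
Proof.
move=> uA rkU; have := gram_mul_unitmx uA rkU.
rewrite proj_AE; move: (A *m U) => B uG.
apply/seteqP; split => [x /= /eqP | _ [y _ <-]].
  rewrite mulmxBl mul1mx subr_eq0 => /eqP xE.
  (* [P x = 0] reads [x = B (B^t* B)^-1 B^t* x], which exhibits the coordinates of [x] in the
     columns of [B]. *)
  by exists (invmx (B^t* *m B) *m B^t* *m x); rewrite // [RHS]xE !mulmxA.
rewrite /mxker /= mulmxA mulmxBl mul1mx -[X in B - X]mulmxA mulmxKV //.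
by rewrite subrr mul0mx.
Qed.

(** With [B = A U], the identity [B^t* P = 0] gives one inclusion; for the other, [P] fixes every
    vector killed by [B^t*]. *)
Lemma mxim_proj_A (C : numClosedFieldType) n k (A : 'M[C]_n)
    (U : 'M[C]_(n, k)) :
  A \in unitmx -> \rank U = k -> mxim (proj_A A U) = orthc (mxim (A *m U)).
Proof.
move=> uA rkU; have := gram_mul_unitmx uA rkU.
rewrite proj_AE orthc_mxim; move: (A *m U) => B uG.
apply/seteqP; split => [_ [y _ <-] | x xB].
  rewrite /mxker /= mulmxA mulmxBr mulmx1 !mulmxA mulmxV // mul1mx.
  by rewrite subrr mul0mx.
exists x => //; move: xB; rewrite /mxker /= => xB.
by rewrite mulmxBl mul1mx -!mulmxA xB !mulmx0 subr0.
Qed.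

Lemma mxker_deflated (C : numClosedFieldType) n k (A : 'M[C]_n)
    (U : 'M[C]_(n, k)) :
  A \in unitmx -> \rank U = k -> mxker (deflated A U) = mxim U.
Proof.
move=> uA rkU; apply/seteqP; split => [x xker | _ [y _ <-]].
  have [y _ AUy] : mxim (A *m U) (A *m x).
    by rewrite -mxker_proj_A // /mxker /= mulmxA.
  by exists y => //; apply: (can_inj (mulKmx uA)); rewrite mulmxA.
have : mxker (proj_A A U) (A *m U *m y) by rewrite mxker_proj_A //; exists y.
by rewrite /mxker /= !mulmxA.
Qed.

Lemma mxim_deflated (C : numClosedFieldType) n k (A : 'M[C]_n)
    (U : 'M[C]_(n, k)) :
  A \in unitmx -> \rank U = k ->
  mxim (deflated A U) = orthc (mxim (A *m U)).
Proof.
move=> uA rkU; rewrite -mxim_proj_A //.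
apply/seteqP; split => _ [y _ <-].
  by exists (A *m y) => //; rewrite mulmxA.
by exists (invmx A *m y) => //; rewrite mulmxA mulmxK.
Qed.

Theorem corollary5p3 (R : realType) (N k : nat)
    (A : 'M[R[i]]_N) (U : 'M[R[i]]_(N, k))
    (hA : A \in unitmx) (hU : \rank U = k) (hk : (0 < k < N)%N) :
  let calU : set 'cV[R[i]]_N := mxim U in
  let AcalU : set 'cV[R[i]]_N := (fun u => A *m u) @` calU in
  let Ahat := deflated A U in
  (mxker Ahat `&` mxim Ahat = [set 0] <-> calU `&` orthc AcalU = [set 0])
  /\ (AcalU = calU -> calU `&` orthc AcalU = [set 0]).
Proof.
move=> calU AcalU Ahat.
have imAU : AcalU = mxim (A *m U).
  apply/seteqP; split => [_ [_ [y _ <-] <-] | _ [y _ <-]].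
    by exists y => //; rewrite mulmxA.
  by exists (U *m y); [exists y | rewrite mulmxA].
split; first by rewrite imAU mxker_deflated // mxim_deflated.
(* Once [AcalU] is replaced by [calU], a common vector is orthogonal to itself, hence zero. *)
move=> ->; apply/seteqP; split => [x [Ux xperp] | _ ->].
  by apply: dotmx_tr_eq0; apply: xperp.
split; first by exists 0; rewrite ?mulmx0.
by move=> y _; rewrite dotmx_tr mulmx0 mxE.
Qed.
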